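(* Let $R$ be a ring, $I$ an ideal of $R$, and $M$ a projective $R$-module. Consider the following conditions: (1) $M$ is an $I$-supplemented module. (2) $M$ is an $I$-semiperfect module. Then $(1)\Rightarrow(2)$, and $(2)\Rightarrow(1)$ holds if $M$ is DM for $I$.
   Context: Rings are associative with identity; modules are unital left modules; ideals are two-sided; ''summand'' means direct summand. DM: a submodule $N\leq M$ is DM in $M$ if for every submodule $X$ of $M$ with $N+X=M$ there is a summand $S$ of $M$ with $S\leq N$ and $M=S+X$. A module $M$ is DM for $I$ if every submodule of $IM$ is DM in $M$. $I$-supplemented: a module $M$ is $I$-supplemented if for every submodule $X$ of $M$ there is a projective submodule $Y$ of $M$ such that $X+Y=M$, $X\cap Y\subseteq IY$ and $X\cap Y$ is DM in $Y$. $I$-semiperfect: a module $M$ is $I$-semiperfect if for every submodule $K$ of $M$ there is a decomposition $M=A\oplus B$ with $A$ projective, $A\subseteq K$ and $K\cap B\subseteq IM$. *)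

(* Defs.v *)
From HB Require Import structures.
From mathcomp Require Import all_boot all_order all_algebra.
From mathcomp Require Import boolp classical_sets.

Set Implicit Arguments.
Unset Strict Implicit.
Unset Printing Implicit Defensive.

Import GRing.Theory.

Local Open Scope classical_set_scope.
Local Open Scope ring_scope.

(* Rings are [pzRingType]: associative and unital, possibly noncommutative,
   the zero ring being allowed. *)

Definition two_sided_ideal (R : pzRingType) (I : set R) : Prop :=
  GRing.zmod_closed [in I] /\
  (forall a x : R, I x -> I (a * x) /\ I (x * a)).

Record submodule (R : pzRingType) (M : lmodType R) := Submodule {
  submod_carrier :> set M;
  submod_carrierP : GRing.submod_closed [in submod_carrier]
}.

Section SubmoduleAsModule.
Context (R : pzRingType) (M : lmodType R) (N : submodule M).

Definition submod_pred : {pred M} := [in (N : set M)].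

Fact submod_pred_closed : GRing.submod_closed submod_pred.
Proof. exact: submod_carrierP. Qed.

HB.instance Definition _ :=
  GRing.isSubmodClosed.Build R M submod_pred submod_pred_closed.

Definition submod_type := {x : M | x \in submod_pred}.

HB.instance Definition _ := SubChoice.on submod_type.
HB.instance Definition _ :=
  [SubChoice_isSubLmodule of submod_type by <:].

End SubmoduleAsModule.

Section Lattice.
Context (R : pzRingType) (M : lmodType R).
Implicit Types N L S T X Y : submodule M.

Fact submodT_closed : GRing.submod_closed [in [set: M]].
Proof. by split=> [|a x y _ _]; rewrite inE. Qed.

Definition submodT : submodule M := Submodule submodT_closed.

Fact submodI_closed X Y : GRing.submod_closed [in X `&` Y].
Proof.
have [X0 Xlin] := submod_carrierP X; have [Y0 Ylin] := submod_carrierP Y.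
split=> [|a x y]; rewrite !in_setI; first by apply/andP.
by move=> /andP[Xx Yx] /andP[Xy Yy]; rewrite Xlin ?Ylin.
Qed.

Definition submodI X Y : submodule M := Submodule (submodI_closed X Y).

Definition sum_set (A B : set M) : set M := [set x + y | x in A & y in B].

Definition ideal_mul (I : set R) (A : set M) : set M :=
  [set z | exists (n : nat) (a : 'I_n -> R) (y : 'I_n -> M),
    (forall k, I (a k) /\ A (y k)) /\ z = \sum_(k < n) a k *: y k].

Definition direct_decomposition L X Y : Prop :=
  sum_set X Y = L /\ X `&` Y = [set 0].

Definition summand S L : Prop := exists T, direct_decomposition L S T.

(* N is DM in L, where L is a submodule of the ambient module M; the submodules
   of the module L are the submodules of M contained in L. *)
Definition DM N L : Prop :=
  N `<=` L /\
  forall X, X `<=` L -> sum_set N X = L ->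
    exists S, [/\ summand S L, S `<=` N & sum_set S X = L].

End Lattice.

Definition projective (R : pzRingType) (P : lmodType R) : Prop :=
  forall (A B : lmodType R) (g : {linear A -> B}) (f : {linear P -> B}),
    range g = setT -> exists h : {linear P -> A}, forall x, g (h x) = f x.

Definition DM_for (R : pzRingType) (I : set R) (M : lmodType R) : Prop :=
  forall N : submodule M, N `<=` ideal_mul I [set: M] -> DM N (submodT M).

Definition supplemented (R : pzRingType) (I : set R) (M : lmodType R) : Prop :=
  forall X : submodule M, exists Y : submodule M,
    [/\ projective (submod_type Y),
        sum_set X Y = [set: M],
        X `&` Y `<=` ideal_mul I Y &
        DM (submodI X Y) Y].

Definition semiperfect (R : pzRingType) (I : set R) (M : lmodType R) : Prop :=
  forall K : submodule M, exists A B : submodule M,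
    [/\ direct_decomposition (submodT M) A B,
        projective (submod_type A),
        A `<=` K &
        K `&` B `<=` ideal_mul I [set: M]].

(* Main.v *)
From HB Require Import structures.
Require Import Defs.
From mathcomp Require Import all_boot all_order all_algebra.
From mathcomp Require Import boolp classical_sets.

(** (1) => (2): given [K], take the [I]-supplement [Y].  Projectivity of [M]
    lifts [M -> M/K] through [Y -> M/K] to some [h : M -> Y] with
    [m - h m \in K].  Then [(K `&` Y) + h M = Y], so DM gives [Y = S (+) T] with
    [S <= K] and [S + h M = Y]; projectivity of [Y] gives [g : Y -> M] with
    [y - h (g y) \in S].  The required decomposition is
    [M = h^-1(S) (+) g(T)].
    (2) => (1): in [M = A (+) B] the summand [B] is the supplement of [K];
    for [(K `&` B) + Z = B], apply DM in [M] to [A + Z]. *)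

Import GRing.Theory.

Local Open Scope classical_set_scope.
Local Open Scope ring_scope.

(* Makes [N x] meaningful for a submodule [N], whose carrier is a [set] that has to be read as a
   predicate. *)
#[local] Identity Coercion fun_of_set : set >-> Funclass.

(** * Elements of submodules and of products with an ideal *)

Section Submodules.
Context {R : pzRingType} {M : lmodType R}.
Implicit Types (I : set R) (A B L N S T X : submodule M) (x y : M).

Lemma submod0 N : N 0.
Proof. by have [/set_mem] := submod_carrierP N. Qed.

Lemma submodZD N a x y : N x -> N y -> N (a *: x + y).
Proof.
have [_ lN] := submod_carrierP N.
by move=> Nx Ny; apply: set_mem; apply: lN; apply: mem_set.
Qed.

Lemma submodD N x y : N x -> N y -> N (x + y).
Proof. by move=> Nx Ny; rewrite -[x]scale1r; apply: submodZD. Qed.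

Lemma submodZ N a x : N x -> N (a *: x).
Proof. by move=> Nx; rewrite -[_ *: _]addr0; apply/submodZD/submod0. Qed.

Lemma submodB N x y : N x -> N y -> N (x - y).
Proof. by move=> Nx Ny; rewrite addrC -scaleN1r; apply: submodZD. Qed.

Lemma val_submod N (u : submod_type N) : N (val u).
Proof. exact: set_mem (valP u). Qed.

Definition to_submod N x (Nx : N x) : submod_type N :=
  exist _ x (mem_set Nx : x \in submod_pred N).

Lemma sum_setE (U V : set M) z :
  sum_set U V z <-> exists x y, [/\ U x, V y & z = x + y].
Proof.
split=> [[x Ux [y Vy <-]]|[x [y [Ux Vy ->]]]]; first by exists x, y.
by exists x => //; exists y.
Qed.

Fact submod_sum_closed A B : GRing.submod_closed [in sum_set A B].
Proof.
split=> [|a _ _ /set_mem[x Ax [y By <-]] /set_mem[x' Ax' [y' By' <-]]].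
  apply/mem_set/sum_setE; exists 0, 0.
  by rewrite addr0; split=> //; apply: submod0.
apply/mem_set/sum_setE; exists (a *: x + x'), (a *: y + y').
by rewrite scalerDr addrACA; split=> //; apply: submodZD.
Qed.

Definition submod_sum A B : submodule M := Submodule (submod_sum_closed A B).

Lemma decompositionP L A B : direct_decomposition L A B ->
  [/\ A `<=` L, B `<=` L,
      forall z, L z -> exists x y, [/\ A x, B y & z = x + y] &
      forall z, A z -> B z -> z = 0].
Proof.
case=> LE I0; split.
- move=> z Az; rewrite -LE; exists z => //.
  by exists 0; [apply: submod0 | rewrite addr0].
- move=> z Bz; rewrite -LE; exists 0; first exact: submod0.
  by exists z; rewrite ?add0r.
- by move=> z Lz; apply/sum_setE; rewrite LE.
- by move=> z Az Bz; have : (A `&` B) z by []; rewrite I0.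
Qed.

Lemma ideal_mul_sub I N : ideal_mul I N `<=` N.
Proof.
move=> _ [n [a [y [IN ->]]]]; elim/big_ind: _ => [|u v|k _].
- exact: submod0.
- exact: submodD.
- by apply: submodZ; case: (IN k).
Qed.

(** Splitting every vector of a combination along [V + W] and keeping the coefficients gives a
    combination in each summand. With a direct decomposition this refines membership in [I Y] or
    [I M]. *)
Lemma ideal_mul_sum_set I (U V W : set M) z :
  (forall x, U x -> sum_set V W x) -> ideal_mul I U z ->
  sum_set (ideal_mul I V) (ideal_mul I W) z.
Proof.
move=> UVW [n [a [y [IU ->]]]].
have /choice[f fP] k : exists p : M * M, [/\ V p.1, W p.2 & y k = p.1 + p.2].
  have [_ /UVW/sum_setE[v [w [Vv Ww yE]]]] := IU k.
  by exists (v, w).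
apply/sum_setE; exists (\sum_k a k *: (f k).1), (\sum_k a k *: (f k).2); split.
- exists n, a, (fun k => (f k).1); split=> // k.
  by have [? _] := IU k; have [] := fP k.
- exists n, a, (fun k => (f k).2); split=> // k.
  by have [? _] := IU k; have [] := fP k.
rewrite -big_split; apply: eq_bigr => k _ /=.
by rewrite -scalerDr; have [_ _ <-] := fP k.
Qed.

(** Linearity carries coefficients in [I] through [g]. As [g] is only defined on the subtype of [N],
    the vectors of the combination are first lifted there, which is where [T <= N] enters. *)
Lemma ideal_mul_image I {N} {Q : lmodType R} (g : {linear submod_type N -> Q})
    (T : set M) (u : submod_type N) :
  T `<=` N -> ideal_mul I T (val u) -> ideal_mul I setT (g u).
Proof.
move=> TN [n [a [y [IT uE]]]].
have yN k : N (y k) by apply: TN; have [] := IT k.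
exists n, a, (fun k => g (to_submod _ _ (yN k))); split.
  by move=> k; have [] := IT k.
have -> : u = \sum_k a k *: to_submod _ _ (yN k).
  apply: val_inj; rewrite uE linear_sum; apply: eq_bigr => k _.
  by rewrite linearZ.
by rewrite linear_sum; apply: eq_bigr => k _; rewrite linearZ.
Qed.

End Submodules.

(** * Linear maps: preimages, images, lifts and projections *)

Section LinearMaps.
Context {R : pzRingType} {P Q : lmodType R} (f : {linear P -> Q}).

Fact submod_preim_closed (S : submodule Q) :
  GRing.submod_closed [in f @^-1` S].
Proof.
split=> [|a x y /set_mem Sx /set_mem Sy]; apply: mem_set => /=.
  by rewrite linear0; apply: submod0.
by rewrite linearP; apply: submodZD.
Qed.

Definition submod_preim (S : submodule Q) : submodule P :=
  Submodule (submod_preim_closed S).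

Fact submod_im_closed (S : submodule P) : GRing.submod_closed [in f @` S].
Proof.
split=> [|a _ _ /set_mem[x Sx <-] /set_mem[y Sy <-]]; apply: mem_set.
  by exists 0; [apply: submod0 | rewrite linear0].
by exists (a *: x + y); [apply: submodZD | rewrite linearP].
Qed.

Definition submod_im (S : submodule P) : submodule Q :=
  Submodule (submod_im_closed S).

End LinearMaps.

(* Lifting the identity of [P] along [S * Q -> P] amounts to lifting
   [P -> P/S] along [Q -> P/S], without forming the quotient. *)
Lemma projective_lift_mod (R : pzRingType) (P Q : lmodType R)
    (f : {linear Q -> P}) (S : submodule P) :
  projective P -> (forall y, exists s q, S s /\ y = s + f q) ->
  exists g : {linear P -> Q}, forall y, S (y - f (g y)).
Proof.
move=> projP Sf.
pose F (u : submod_type S * Q) : P := val u.1 + f u.2.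
have F_linear : linear F.
  by move=> a u v; rewrite /F /= !linearP /= scalerDr addrACA.
pose FL : {linear (submod_type S * Q)%type -> P} :=
  HB.pack F (GRing.isLinear.Build _ _ _ _ F F_linear).
have F_onto : range FL = setT.
  apply/seteqP; split=> // y _; have [s [q [Ss ->]]] := Sf y.
  by exists (to_submod _ _ Ss, q).
have [k kP] := projP _ _ FL idfun F_onto.
exists (snd \o k) => y /=.
have /= {1}<- := kP y.
by rewrite /F addrK; apply: val_submod.
Qed.

(** As [A] meets [B] trivially, [p x] is the only [a] in [A] with [x - a] in [B]. This uniqueness
    makes the function obtained by choice linear and the identity on [A]. *)
Lemma summand_projection (R : pzRingType) (M : lmodType R) (A B : submodule M) :
  direct_decomposition (submodT M) A B ->
  exists p : {linear M -> submod_type A}, forall a, p (val a) = a.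
Proof.
move=> /decompositionP[_ _ dec inj].
have /choice[p pP] x : exists a : submod_type A, B (x - val a).
  have [//|a [b [Aa Bb ->]]] := dec x.
  by exists (to_submod _ _ Aa); rewrite /= addrC addKr.
have p_uniq x a : B (x - val a) -> p x = a.
  move=> Bxa; apply/val_inj/eqP; rewrite -subr_eq0; apply/eqP/inj.
    by apply: submodB; apply: val_submod.
  by have := submodB _ _ _ Bxa (pP x); rewrite opprB addrC addrA subrK.
have p_linear : linear p.
  move=> c x y; apply: p_uniq; rewrite linearP /= addrACA -scalerDr.
  by apply: submodZD.
pose pL : {linear M -> submod_type A} :=
  HB.pack p (GRing.isLinear.Build _ _ _ _ p p_linear).
exists pL => a /=.
by apply: p_uniq; rewrite subrr; apply: submod0.
Qed.

(** A map out of [A] extends to [M] along the projection; the lift found there is restricted to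
    [A]. *)
Lemma projective_summand (R : pzRingType) (M : lmodType R) (A B : submodule M) :
  projective M -> direct_decomposition (submodT M) A B ->
  projective (submod_type A).
Proof.
move=> projM /summand_projection[p pK] U V g f g_onto.
have [h hP] := projM _ _ g (f \o p) g_onto.
by exists (h \o val) => a /=; rewrite hP /= pK.
Qed.

Lemma direct_decompositionC (R : pzRingType) (M : lmodType R)
    (L A B : submodule M) :
  direct_decomposition L A B -> direct_decomposition L B A.
Proof.
rewrite /direct_decomposition => -[<- I0]; split; last by rewrite setIC.
by apply/seteqP; split=> z [x Ux [y Vy <-]]; exists y => //; exists x;
  rewrite // addrC.
Qed.

(** * From supplements to decompositions *)

Lemma supplemented_semiperfect (R : pzRingType) (I : set R) (M : lmodType R) :
  projective M -> supplemented I M -> semiperfect I M.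
Proof.
move=> projM suppM K.
have [Y [projY KY KIY [KYY dmKY]]] := suppM K.
have [h hP] : exists h : {linear M -> submod_type Y},
    forall m, K (m - val (h m)).
  apply: projective_lift_mod => // m.
  have : sum_set K Y m by rewrite KY.
  move=> /sum_setE[k [y [Kk Yy ->]]].
  by exists k, (to_submod _ _ Yy).
pose hM := submod_im (val \o h) (submodT M).
have hMY : hM `<=` Y by move=> _ [m _ <-]; apply: val_submod.
have sum_hM : sum_set (submodI K Y) hM = Y.
  apply/seteqP; split=> [_ [x [_ Yx] [y /hMY Yy <-]]|y Yy].
    exact: submodD.
  apply/sum_setE; exists (y - val (h y)), (val (h y)); split.
  - by split=> //; apply/submodB/val_submod.
  - by exists y.
  - by rewrite subrK.
have [S [[T /decompositionP[SY TY dec inj]] SK sum_S]] := dmKY _ hMY sum_hM.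
have [g gP] : exists g : {linear submod_type Y -> M},
    forall y, submod_preim val S (y - h (g y)).
  apply: projective_lift_mod => // y.
  have : sum_set S hM (val y) by rewrite sum_S; apply: val_submod.
  move=> /sum_setE[s [_ [Ss [m _ <-] yE]]].
  exists (to_submod _ _ (SY _ Ss)), m; split=> //.
  by apply: val_inj; rewrite yE linearD.
have {}gP y : S (val y - val (h (g y))).
  by rewrite -(linearB val); apply: gP.
pose A := submod_preim (val \o h) S.
pose B := submod_im g (submod_preim val T).
have decM : direct_decomposition (submodT M) A B.
  split; apply/seteqP; split=> //.
  (* With [h m = s + t], the vector [m - g t] lies in [A], because [h] sends it to
     [s + (t - h (g t))], a sum of two elements of [S]. *)
  - move=> m _; have [s [t [Ss Tt hE]]] := dec _ (val_submod _ (h m)).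
    pose t' := to_submod _ _ (TY _ Tt).
    apply/sum_setE; exists (m - g t'), (g t'); rewrite subrK; split=> //.
      rewrite /A /= !linearB /= hE -addrA.
      by apply: submodD => //; apply: (gP t').
    by exists t'.
  (* For [m = g t] in [A], both [t - h (g t)] and [h (g t)] are in [S], so [t] is in both [S] and
     [T] and vanishes. *)
  - move=> m [/= Sm [t /= Tt tE]]; have t0 : val t = 0.
      apply: inj => //; rewrite -[val t](subrK (val (h (g t)))).
      by apply: submodD => //; rewrite tE.
    by rewrite -tE (_ : t = 0) ?linear0 //; apply: val_inj; rewrite t0 linear0.
  - by move=> _ ->; split; apply: submod0.
exists A, B; split=> //.
- exact: projective_summand decM.
- move=> m /SK[Km _]; rewrite -[m](subrK (val (h m))).
  exact: submodD.
(* Here [m = g t] and [h m] lies in [K] and [Y], hence in [I Y], so [h m = s + t1] with [s] in [I S]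
   and [t1] in [I T]. The difference [t - t1 = (t - h m) + s] lies in [S] and in [T], so [t = t1]
   and [m = g t1] is in [I M]. *)
- move=> m [Km [t /= Tt tE]].
  have Khm : K (val (h m)).
    rewrite (_ : val (h m) = m - (m - val (h m))); last by rewrite subKr.
    exact: submodB.
  have /KIY : (K `&` Y) (val (h m)) by split=> //; apply: val_submod.
  move=> /(ideal_mul_sum_set _ _ S T)[y /dec/sum_setE //|s ISs [t1 ITt1 hE]].
  have [Ss Tt1] := (ideal_mul_sub _ _ _ ISs, ideal_mul_sub _ _ _ ITt1).
  have t1E : val t = t1.
    apply/eqP; rewrite -subr_eq0; apply/eqP; apply: inj; last exact: submodB.
    rewrite (_ : _ - _ = (val t - val (h (g t))) + s); first exact: submodD.
    by rewrite tE -hE opprD addrA addrAC addrNK.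
  by rewrite -tE; apply: (ideal_mul_image _ _ _ _ TY); rewrite t1E.
Qed.

(** * From decompositions to supplements *)

Lemma semiperfect_supplemented (R : pzRingType) (I : set R) (M : lmodType R) :
  projective M -> DM_for I M -> semiperfect I M -> supplemented I M.
Proof.
move=> projM dmM spM K.
have [A [B [decM _ AK KB]]] := spM K.
have [_ _ dec inj] := decompositionP _ _ _ decM.
exists B; split.
- exact: projective_summand (direct_decompositionC _ _ _ _ _ decM).
- apply/seteqP; split=> // m _; have [//|a [b [/AK Ka Bb ->]]] := dec m.
  by apply/sum_setE; exists a, b.
(* Membership in [I M] must be sharpened to [I B]: the [I A] component of [m] is in [B] as well as
   in [A], hence zero. *)
- move=> m [Km Bm]; have Im := KB _ (conj Km Bm).
  have : sum_set (ideal_mul I A) (ideal_mul I B) m.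
    by apply: ideal_mul_sum_set Im => x _; apply/sum_setE/dec.
  case=> a /[dup]/ideal_mul_sub Aa _ [b IBb mE].
  have Bb := ideal_mul_sub _ _ _ IBb.
  have a0 : a = 0 by apply: inj => //; rewrite -[a](addrK b) mE; apply: submodB.
  by rewrite -mE a0 add0r.
split=> [m []//|Z ZB sumZ].
have [_ dmKB] := dmM (submodI K B) KB.
have sumAZ : sum_set (submodI K B) (submod_sum A Z) = submodT M.
  apply/seteqP; split=> // m _; have [//|a [b [Aa Bb ->]]] := dec m.
  move: Bb; rewrite -sumZ => -[n Nn [z Zz <-]].
  apply/sum_setE; exists n, (a + z); rewrite addrCA; split=> //.
  by apply/sum_setE; exists a, z.
have [S [[T /decompositionP[_ _ decST injST]] SKB sumS]] :=
  dmKB (submod_sum A Z) (fun _ _ => Logic.I) sumAZ.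
have SB : S `<=` B by move=> s /SKB[].
exists S; split=> //.
  (* By the modular law, a complement of [S] in [M] cuts [B] in a complement of [S] in [B], since
     [S <= B]. *)
  exists (submodI T B); split; apply/seteqP; split.
  - by move=> _ [s /SB Bs [t [_ Bt] <-]]; apply: submodD.
  - move=> b Bb; have [//|s [t [Ss Tt bE]]] := decST b.
    apply/sum_setE; exists s, t; split=> //; split=> //.
    rewrite (_ : t = b - s); first by apply: submodB => //; apply: SB.
    by rewrite bE addrC addKr.
  - by move=> s [Ss [Ts _]]; apply: injST.
  - by move=> _ ->; split; apply: submod0.
apply/seteqP; split=> [_ [s /SB Bs [z /ZB Bz <-]]|b Bb]; first exact: submodD.
(* Writing [b = s + (a + z)], the term [a = b - (s + z)] falls in [B], so it is zero and [S + Z]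
   already contains [b]. *)
have : sum_set S (submod_sum A Z) b by rewrite sumS.
move=> /sum_setE[s [_ [Ss [a Aa [z Zz <-]] bE]]].
suff a0 : a = 0 by apply/sum_setE; exists s, z; rewrite bE a0 add0r.
apply: inj => //; rewrite (_ : a = b - (s + z)).
  by apply: submodB => //; apply: submodD; [apply: SB | apply: ZB].
by rewrite bE addrCA addrK.
Qed.

Theorem theorem5p3 (R : pzRingType) (I : set R) (M : lmodType R)
  (hI : two_sided_ideal I) (hM : projective M) :
  (supplemented I M -> semiperfect I M) /\
  (DM_for I M -> semiperfect I M -> supplemented I M).
Proof.
by split; [apply: supplemented_semiperfect | apply: semiperfect_supplemented].
Qed.
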